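(* Let $f:P\to Q$ be an affine map between polytopes, and write $f=f_{\mathrm{inj}}\circ f_{\mathrm{surj}}$ where $f_{\mathrm{surj}}:P\to f(P)$ is $f$ with restricted codomain and $f_{\mathrm{inj}}:f(P)\to Q$ is the inclusion. Then: (1) If $f$ is a vertex map, then so are $f_{\mathrm{inj}}$ and $f_{\mathrm{surj}}$. (2) If every vertex of $f(P)$ is a vertex of $Q$ and $f_{\mathrm{surj}}$ is a deflation, then $f$ is a vertex map. (3) There exist affine maps $f$ between polytopes that are not vertex maps but for which $f_{\mathrm{inj}}$ is a vertex map and $f_{\mathrm{surj}}$ is a deflation; in particular the converse of (1) fails.
   Context: Polytopes are convex polytopes in finite-dimensional real vector spaces. For polytopes $P,Q$, $\mathrm{Hom}(P,Q)$ is the set of affine maps $P\to Q$, which is a convex polytope in the affine space of affine maps $\mathrm{aff}(P)\to\mathrm{aff}(Q)$. An affine map $f:P\to Q$ is a vertex map if it is a vertex of $\mathrm{Hom}(P,Q)$. A map $f:P\to Q$ is a deflation if (i) $f$ is surjective, (ii) $f$ is a vertex map, and (iii) for every vertex $v$ of $P$, either $f(v)$ is a vertex of $Q$ or $f(v)$ lies in the relative interior of $Q$. *)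

(* Defs.v *)
From HB Require Import structures.
From mathcomp Require Import all_boot all_order all_algebra.
From mathcomp Require Import all_classical all_reals.

Set Implicit Arguments.
Unset Strict Implicit.
Unset Printing Implicit Defensive.

Import Order.TTheory GRing.Theory Num.Theory.

Local Open Scope classical_set_scope.
Local Open Scope ring_scope.

Section ConvexSets.
Variables (R : realType) (E : lmodType R).
Implicit Types (A : set E) (x : E).

Definition conv_hull A : set E :=
  [set x | exists (n : nat) (c : 'I_n -> R) (a : 'I_n -> E),
    [/\ forall i, A (a i), forall i, 0 <= c i,
        \sum_i c i = 1 & x = \sum_i c i *: a i]].

Definition aff_hull A : set E :=
  [set x | exists (n : nat) (c : 'I_n -> R) (a : 'I_n -> E),
    [/\ forall i, A (a i), \sum_i c i = 1 & x = \sum_i c i *: a i]].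

(* Vertices as extreme points.  The ambient module is arbitrary so that the
   definition applies both to polytopes and to Hom-sets of functions. *)
Definition is_vertex A x : Prop :=
  A x /\ forall (y z : E) (t : R), A y -> A z -> 0 < t < 1 ->
    x = t *: y + (1 - t) *: z -> y = x /\ z = x.

End ConvexSets.

Section Polytopes.
Variables (R : realType) (V : vectType R).
Implicit Type P : set V.

(* The empty polytope is allowed. *)
Definition is_polytope P : Prop :=
  exists2 A : set V, finite_set A & P = conv_hull A.

(* Interior of P in aff_hull P, for the canonical topology of V: the boxes
   around x with respect to a basis of V form a base of neighbourhoods of x. *)
Definition rel_interior P : set V :=
  [set x | P x /\ exists2 e : R, 0 < e & forall y, aff_hull P y ->
    (forall i, `|coord (vbasis {:V}) i (y - x)| < e) -> P y].

End Polytopes.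

Section Maps.
Variables (R : realType) (V W : vectType R).
Implicit Types (P : set V) (Q : set W).

(* Preservation of all affine combinations of points of P that lie in P, i.e.
   g is the restriction of an affine map aff_hull P -> W. *)
Definition is_affine P (g : P -> W) : Prop :=
  forall (n : nat) (c : 'I_n -> R) (a : 'I_n -> P) (x : P),
    \sum_i c i = 1 -> val x = \sum_i c i *: val (a i) ->
    g x = \sum_i c i *: g (a i).

Definition affine_map P Q (f : P -> Q) : Prop :=
  is_affine (fun x => val (f x)).

(* Maps P -> Q are viewed as W-valued functions, so that Hom P Q is a subset
   of the R-module P -> W. *)
Definition Hom P Q : set (P -> W) :=
  [set g | exists2 f : P -> Q, affine_map f & g = (fun x => val (f x))].

Definition vertex_map P Q (f : P -> Q) : Prop :=
  is_vertex (@Hom P Q) (fun x => val (f x)).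

Definition deflation P Q (f : P -> Q) : Prop :=
  [/\ forall y : Q, exists x : P, f x = y,
      vertex_map f
    & forall v : P, is_vertex P (val v) ->
        is_vertex Q (val (f v)) \/ rel_interior Q (val (f v))].

Definition map_image P Q (f : P -> Q) : set W := range (fun x => val (f x)).

Lemma map_image_sub P Q (f : P -> Q) : map_image f `<=` Q.
Proof. by move=> _ [x _ <-]; exact: set_valP. Qed.

Lemma mem_map_image P Q (f : P -> Q) (x : P) : val (f x) \in map_image f.
Proof. by apply: mem_set; exists x. Qed.

Definition f_surj P Q (f : P -> Q) : P -> map_image f :=
  fun x => SigSub (mem_map_image f x).

Definition f_inj P Q (f : P -> Q) : map_image f -> Q :=
  subfun (@map_image_sub P Q f).

Lemma f_factor P Q (f : P -> Q) : f = f_inj (f:=f) \o f_surj f.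
Proof. by apply/funext => x; apply: val_inj. Qed.

End Maps.

Arguments f_inj {R V W P Q} f.
Arguments f_surj {R V W P Q} f.

(* Main.v *)
(* (1) A convex decomposition of [f_surj f] or [f_inj f] yields one of [f] by
   composing with the other factor, the first factor being surjective.
   (2) A decomposition of [f] is trivial at the vertices of [P] sent to vertices,
   and at the other vertices [f] lies in the relative interior of the image, so
   [f_surj f] could be perturbed along a rank-one shadow of [g - f].
   (3) A tetrahedron is mapped onto a trapezoid inscribed in a triangle, with the
   long side of the trapezoid a side of the triangle.  The inclusion of the
   trapezoid is rigid, because its two free corners are bound by parallelism; but
   their preimages in the tetrahedron are affinely independent, so they can slide
   along the edges of the triangle separately. *)
From HB Require Import structures.
Require Import Defs.
From mathcomp Require Import all_boot all_order all_algebra.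
From mathcomp Require Import all_classical all_reals.
From mathcomp Require Import ring lra.

Set Implicit Arguments.
Unset Strict Implicit.
Unset Printing Implicit Defensive.

Import Order.TTheory GRing.Theory Num.Theory.

Local Open Scope classical_set_scope.
Local Open Scope ring_scope.

(** * Convex hulls of finite sets and their vertices *)

Section ConvexHull.
Variables (R : realType) (E : lmodType R).
Implicit Types (A C : set E) (s : seq E) (x : E).

(** Exchanging [y] and [z] replaces [t] by [1 - t], so one of the two equalities suffices. *)
Lemma is_vertexI A x : A x ->
  (forall y z t, A y -> A z -> 0 < t < 1 ->
     x = t *: y + (1 - t) *: z -> y = x) -> is_vertex A x.
Proof.
move=> Ax Hx; split=> // y z t Ay Az t01 xE; split; first exact: Hx xE.
apply: (Hx z y (1 - t)) => //; first by lra.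
by rewrite opprB addrCA subrr addr0 addrC.
Qed.

Lemma sub_conv_hull A : A `<=` conv_hull A.
Proof.
move=> x Ax; exists 1%N, (fun=> 1), (fun=> x).
by split=> //; rewrite big_ord1 ?scale1r.
Qed.

(** Coefficients of equal points are added up. All combinations then share the index list [s], so
    they can be mixed coefficientwise. *)
Lemma conv_hull_seqP s x : uniq s ->
  conv_hull [set` s] x <->
  exists c : E -> R, [/\ forall v, 0 <= c v, \sum_(v <- s) c v = 1
    & x = \sum_(v <- s) c v *: v].
Proof.
move=> us; split=> [[n [c [a [sa c0 c1 ->]]]]|[c [c0 c1 ->]]].
  exists (fun v => \sum_(i | a i == v) c i); split=> [v||].
  - exact: sumr_ge0.
  - under eq_bigr do rewrite big_mkcond.
    rewrite exchange_big /= -c1; apply: eq_bigr => i _.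
    rewrite (bigD1_seq (a i)) //=; last exact: sa.
    by rewrite eqxx big1 ?addr0 // => v; rewrite eq_sym => /negPf ->.
  - under [RHS]eq_bigr do rewrite scaler_suml big_mkcond.
    rewrite exchange_big /=; apply: eq_bigr => i _.
    rewrite (bigD1_seq (a i)) //=; last exact: sa.
    by rewrite eqxx big1 ?addr0 // => v; rewrite eq_sym => /negPf ->.
exists (size s), (fun i => c (s`_i)), (fun i => s`_i); split=> //.
- by move=> i; exact: mem_nth.
- by rewrite -c1 (big_nth 0) big_mkord.
- by rewrite (big_nth 0) big_mkord.
Qed.

Lemma finite_set_uniq_seq A : finite_set A ->
  exists2 s : seq E, uniq s & A = [set` s].
Proof.
move=> /finite_seqP[s ->]; exists (undup s); first exact: undup_uniq.
by apply/seteqP; split=> x /=; rewrite mem_undup.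
Qed.

Lemma conv_hull_idem A : finite_set A ->
  conv_hull (conv_hull A) `<=` conv_hull A.
Proof.
move=> /finite_set_uniq_seq[s us ->] _ [n [c [a [sa c0 c1 ->]]]].
have /choice[d dP] i := (conv_hull_seqP (a i) us).1 (sa i).
apply/conv_hull_seqP => //; exists (fun v => \sum_i c i * d i v); split.
- by move=> v; apply: sumr_ge0 => i _; rewrite mulr_ge0 //; case: (dP i).
- rewrite exchange_big /= -c1; apply: eq_bigr => i _.
  by rewrite -mulr_sumr; case: (dP i) => _ -> _; rewrite mulr1.
- under [RHS]eq_bigr do rewrite scaler_suml.
  rewrite exchange_big /=; apply: eq_bigr => i _.
  case: (dP i) => _ _ {1}->; rewrite scaler_sumr.
  by apply: eq_bigr => v _; rewrite scalerA.
Qed.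

(** Isolating a term with nonzero coefficient writes [x] as a mixture of [a i] and the renormalized
    rest; extremality then forces [x = a i]. *)
Lemma conv_hull_vertex A x : is_vertex (conv_hull A) x -> A x.
Proof.
move=> [[n [c [a [Aa c0 c1 xE]]]] vx].
have [i ci0] : exists i, c i != 0.
  apply: contrapT => /forallNP c_eq0.
  move: c1; rewrite big1 => [/eqP|i _]; first by rewrite eq_sym oner_eq0.
  by apply/eqP/negP=> /negP; exact: c_eq0.
have sumD1 : \sum_(j | j != i) c j = 1 - c i.
  by move: c1; rewrite (bigD1 i) //= => <-; rewrite [RHS]addrC addKr.
(* Renormalizing divides by [1 - c i], so coefficient 1 is treated apart: all other coefficients
   vanish. *)
have [ci1|ci1] := eqVneq (c i) 1.
  suff -> : x = a i by [].
  rewrite xE (bigD1 i) //= ci1 scale1r big1 ?addr0 // => j ji.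
  suff -> : c j = 0 by rewrite scale0r.
  move: sumD1; rewrite ci1 subrr => /eqP; rewrite psumr_eq0 //.
  by move=> /allP/(_ j); rewrite mem_index_enum ji => /(_ isT)/eqP.
have ci_lt1 : c i < 1.
  by rewrite lt_neqAle ci1 -subr_ge0 -sumD1 sumr_ge0.
have ci_gt0 : 0 < c i by rewrite lt_neqAle eq_sym ci0 /=.
have d0 : 1 - c i != 0 by rewrite subr_eq0 eq_sym.
pose d j := if j == i then 0 else c j / (1 - c i).
have [||||<- _ //] := vx (a i) (\sum_j d j *: a j) (c i).
- exact: sub_conv_hull.
- exists n, d, a; split=> //.
  + move=> j; rewrite /d; case: ifP => // _.
    by rewrite divr_ge0 // subr_ge0 ltW.
  + rewrite (bigD1 i) //= /d eqxx add0r.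
    under eq_bigr => j /negPf -> do [].
    by rewrite -mulr_suml sumD1 divff.
- by rewrite ci_gt0.
- rewrite {1}xE (bigD1 i) //=; congr (_ + _).
  rewrite [in RHS](bigD1 i) //= {1}/d eqxx scale0r add0r scaler_sumr.
  apply: eq_bigr => j /negPf ji.
  by rewrite /d ji scalerA mulrCA divff // mulr1.
Qed.

(* If [a = t y + (1-t) z] with [y, z] in the hull, moving the [a]-terms of [y]
   and [z] to the left exhibits [a] as a combination of the other points. *)
Lemma conv_hull_rem_nonvertex s a : uniq s -> a \in s ->
  ~ is_vertex (conv_hull [set` s]) a -> conv_hull [set` rem a s] a.
Proof.
move=> us sa nva; have ur : uniq (rem a s) by exact: rem_uniq.
apply: contrapT => nra; apply: nva; apply: is_vertexI.
  exact: sub_conv_hull.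
move=> y z t /(conv_hull_seqP _ us)[c [c0 c1 yE]].
move=> /(conv_hull_seqP _ us)[d [d0 d1 zE]] t01 aE.
have sumE (M : nmodType) (F : E -> M) :
    \sum_(v <- s) F v = F a + \sum_(v <- rem a s) F v.
  by rewrite (perm_big _ (perm_to_rem sa)) big_cons.
rewrite !sumE in c1 d1 yE zE.
pose g := t * (1 - c a) + (1 - t) * (1 - d a).
have cE : 1 - c a = \sum_(v <- rem a s) c v by rewrite -c1 [LHS]addrC addKr.
have dE : 1 - d a = \sum_(v <- rem a s) d v by rewrite -d1 [LHS]addrC addKr.
pose e v := t * c v + (1 - t) * d v.
have e0 v : 0 <= e v by rewrite addr_ge0 // mulr_ge0 //; lra.
have sume : \sum_(v <- rem a s) e v = g.
  by rewrite big_split /= -!mulr_sumr /g cE dE.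
have ga : g *: a = \sum_(v <- rem a s) e v *: v.
  have -> : g *: a = a - e a *: a.
    by rewrite -{2}[a]scale1r -scalerBl /g /e; congr (_ *: _); ring.
  rewrite {1}aE yE zE !scalerDr addrACA !scalerA -scalerDl [LHS]addrC addKr.
  under [RHS]eq_bigr do rewrite scalerDl -!scalerA.
  by rewrite [RHS]big_split /= -!scaler_sumr.
(* [g] is the weight that the mixture of [y] and [z] puts on points other than [a]. If it is zero,
   [y] is [a] itself; otherwise dividing by [g] puts [a] in the hull of the others. *)
have [g0|g0] := eqVneq g 0.
  have cr0 : \sum_(v <- rem a s) c v = 0.
    have t0 : 0 < t by lra.
    have t1 : 0 < 1 - t by lra.
    move/eqP: g0; rewrite /g cE dE paddr_eq0 ?mulr_ge0 ?sumr_ge0 ?ltW // => /andP[+ _].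
    by rewrite mulf_eq0 gt_eqF //= => /eqP.
  rewrite yE; have -> : c a = 1 by rewrite -c1 cr0 addr0.
  rewrite scale1r big_seq big1 ?addr0 // => v rv.
  move/eqP: cr0; rewrite psumr_eq0 // => /allP/(_ v rv)/= /eqP ->.
  by rewrite scale0r.
case: nra; apply/conv_hull_seqP => //; exists (fun v => g^-1 * e v); split.
- by move=> v; rewrite mulr_ge0 // invr_ge0 -sume sumr_ge0.
- by rewrite -mulr_sumr sume mulVf.
- under eq_bigr do rewrite -scalerA.
  by rewrite -scaler_sumr -ga scalerA mulVf // scale1r.
Qed.

Lemma conv_hull_rem s a : uniq s -> a \in s ->
  conv_hull [set` rem a s] a -> conv_hull [set` rem a s] = conv_hull [set` s].
Proof.
move=> us sa ra; have fr := finite_seq (rem a s).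
apply/seteqP; split.
  move=> _ [n [c [b [rb c0 c1 ->]]]]; exists n, c, b; split=> // i.
  exact: (mem_rem (rb i)).
move=> _ [n [c [b [sb c0 c1 ->]]]]; apply: conv_hull_idem => //.
exists n, c, b; split=> // i; have [->//|bia] := eqVneq (b i) a.
by apply: sub_conv_hull; rewrite /= mem_rem_uniq // !inE bia; exact: sb.
Qed.

(** Discarding a non-vertex from the list does not change the hull, so induction on the size ends
    with a generating list of vertices. *)
Lemma polytope_vertices s : uniq s -> exists s' : seq E,
  [/\ uniq s', conv_hull [set` s'] = conv_hull [set` s]
    & forall v, v \in s' -> is_vertex (conv_hull [set` s]) v].
Proof.
have [n] := ubnP (size s); elim: n s => // n IH s sn us.
have [allv|/existsNP[a /not_implyP[sa nva]]] :=
  pselect (forall v, v \in s -> is_vertex (conv_hull [set` s]) v).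
  by exists s.
have ra := conv_hull_rem_nonvertex us sa nva.
have [||s' [us' s'E vs']] := IH (rem a s).
- by rewrite size_rem //; case: (s) sa sn.
- exact: rem_uniq.
by exists s'; rewrite (conv_hull_rem us sa ra) in s'E vs'.
Qed.

End ConvexHull.

Lemma conv_hull_halfspace (R : realType) (E : lmodType R) (A : set E)
    (l : E -> R^o) (k : R) : linear l ->
  (forall x, A x -> l x <= k) -> forall x, conv_hull A x -> l x <= k.
Proof.
move=> lin lA _ [n [c [a [Aa c0 c1 ->]]]].
pose L := HB.pack_for {linear E -> R^o} l (GRing.isLinear.Build _ _ _ _ l lin).
rewrite -[l]/(L : E -> R^o) linear_sum -[k]mul1r -c1 mulr_suml.
by apply: ler_sum => i _; rewrite linearZ /= ler_wpM2l // lA.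
Qed.

(** * Affine maps and extremality in Hom-sets *)

Section AffineMaps.
Variables (R : realType) (V W : vectType R).
Implicit Types (P : set V) (Q : set W).

Lemma is_affine_conv P (A : set V) (C : set W) (g : P -> W) :
  P `<=` conv_hull A -> A `<=` P -> is_affine g -> conv_hull C `<=` C ->
  (forall v : P, A (val v) -> C (g v)) -> forall x, C (g x).
Proof.
move=> PA AP gaff CC gA x; have /PA[n [c [a [Aa c0 c1 xE]]]] := set_valP x.
pose b i : P := SigSub (mem_set (AP _ (Aa i))).
apply: CC; exists n, c, (g \o b); split=> //.
  by move=> i; apply: gA; exact: Aa.
exact: (gaff _ _ b).
Qed.

Lemma is_affine_eq P (A : set V) (g h : P -> W) :
  P `<=` conv_hull A -> A `<=` P -> is_affine g -> is_affine h ->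
  (forall v : P, A (val v) -> g v = h v) -> g =1 h.
Proof.
move=> PA AP gaff haff gh x.
have /PA[n [c [a [Aa c0 c1 xE]]]] := set_valP x.
pose b i : P := SigSub (mem_set (AP _ (Aa i))).
rewrite (gaff _ _ b _ c1 xE) (haff _ _ b _ c1 xE).
by apply: eq_bigr => i _; rewrite gh //; exact: Aa.
Qed.

Lemma is_affine_val P : is_affine (fun x : P => val x).
Proof. by []. Qed.

Lemma is_affineD P (g h : P -> W) :
  is_affine g -> is_affine h -> is_affine (fun x => g x + h x).
Proof.
move=> gaff haff n c a x c1 xE; rewrite (gaff _ _ _ _ c1 xE) (haff _ _ _ _ c1 xE).
by rewrite -big_split; apply: eq_bigr => i _; rewrite /= scalerDr.
Qed.

Lemma is_affine_linear (U : vectType R) P (l : {linear W -> U}) (g : P -> W) :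
  is_affine g -> is_affine (fun x => l (g x)).
Proof.
move=> gaff n c a x c1 xE; rewrite (gaff _ _ _ _ c1 xE) linear_sum.
by apply: eq_bigr => i _; rewrite linearZ.
Qed.

Lemma is_affine_scaler P (g : P -> R^o) (w : W) :
  is_affine g -> is_affine (fun x => g x *: w).
Proof.
move=> gaff n c a x c1 xE; rewrite (gaff _ _ _ _ c1 xE) scaler_suml.
by apply: eq_bigr => i _; rewrite scalerA.
Qed.

Lemma is_affine_comp (U : vectType R) P Q (f : P -> Q) (g : Q -> U) :
  affine_map f -> is_affine g -> is_affine (g \o f).
Proof.
move=> faff gaff n c a x c1 xE.
by apply: (gaff _ _ (f \o a)) => //; exact: faff.
Qed.

Lemma HomP P Q (g : P -> W) :
  @Defs.Hom R V W P Q g <-> is_affine g /\ forall x, Q (g x).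
Proof.
split=> [[f faff ->]|[gaff gQ]]; first by split=> // x; exact: set_valP.
by exists (fun x => SigSub (mem_set (gQ x))).
Qed.

(** The competitors [g] and [h] are plain [W]-valued functions, so they can be carried between [f]
    and its two factors, whose domains and codomains differ. *)
Lemma vertex_mapP P Q (f : P -> Q) : vertex_map f <->
  affine_map f /\ forall (g h : P -> W) (t : R), is_affine g -> is_affine h ->
    (forall x, Q (g x)) -> (forall x, Q (h x)) -> 0 < t < 1 ->
    (forall x, val (f x) = t *: g x + (1 - t) *: h x) ->
    forall x, g x = val (f x).
Proof.
split=> [[/HomP[faff _] vf]|[faff vf]].
  split=> // g h t gaff haff gQ hQ t01 fE x.
  have gH : @Defs.Hom R V W P Q g by apply/HomP.
  have hH : @Defs.Hom R V W P Q h by apply/HomP.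
  have [|-> //] := vf g h t gH hH t01.
  by apply/funext => y; rewrite fE.
apply: is_vertexI => [|g h t /HomP[gaff gQ] /HomP[haff hQ] t01 fE].
  by apply/HomP; split=> // x; exact: set_valP.
by apply/funext; apply: (vf g h t) => // x; rewrite (congr1 (@^~ x) fE).
Qed.

End AffineMaps.

(** * Factorization through the image *)

Section Factorization.
Variables (R : realType) (V W : vectType R).
Implicit Types (P : set V) (Q : set W).

Lemma map_image_f_surj P Q (f : P -> Q) (y : map_image f) :
  exists x, f_surj f x = y.
Proof. by have [x _ xE] := set_valP y; exists x; exact: val_inj. Qed.

Lemma vertex_map_f_surj P Q (f : P -> Q) :
  vertex_map f -> vertex_map (f_surj f).
Proof.
move=> /vertex_mapP[faff vf]; apply/vertex_mapP; split=> //.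
move=> g h t gaff haff gQ hQ; apply: (vf g h t) => // x;
  exact: map_image_sub.
Qed.

Lemma vertex_map_f_inj P Q (f : P -> Q) :
  vertex_map f -> vertex_map (f_inj f).
Proof.
move=> /vertex_mapP[faff vf]; apply/vertex_mapP; split=> //.
move=> g h t gaff haff gQ hQ t01 fE y; have [x <-] := map_image_f_surj y.
apply: (vf (g \o f_surj f) (h \o f_surj f) t) => //.
- exact: is_affine_comp.
- exact: is_affine_comp.
- by move=> z /=.
- by move=> z /=.
- by move=> z /=; rewrite -fE.
Qed.

Lemma conv_hull_map_image P Q (f : P -> Q) :
  is_polytope P -> affine_map f -> conv_hull (map_image f) `<=` map_image f.
Proof.
move=> [A fA PE] faff _ [n [c [b [Ab c0 c1 ->]]]].
have convP : conv_hull P `<=` P by rewrite PE; exact: conv_hull_idem.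
have /choice[a aE] i : exists a, val (f a) = b i.
  by have [a _ <-] := Ab i; exists a.
have Px : P (\sum_i c i *: val (a i)).
  apply: convP.
  by exists n, c, (fun i => val (a i)); split=> // i; exact: set_valP.
exists (SigSub (mem_set Px)) => //.
by rewrite (faff n c a) //; apply: eq_bigr => i _; rewrite aE.
Qed.

Lemma rel_interior_absorb Q (w d : W) : rel_interior Q w ->
  (forall r, aff_hull Q (w + r *: d)) ->
  exists2 e : R, 0 < e & forall r, `|r| <= e -> Q (w + r *: d).
Proof.
move=> [_ [e e0 He]] wd; pose b := vbasis {:W}.
(* The summand 1 makes [M] positive and strictly larger than every coordinate of [d], as the strict
   bounds of the box require. *)
pose M : R := 1 + \sum_i `|coord b i d|.
have M0 : 0 < M by rewrite ltr_pwDl // sumr_ge0.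
exists (e / M); first by rewrite divr_gt0.
move=> r re; apply: He => // i; rewrite [w + _]addrC addrK linearZ /= normrM.
apply: le_lt_trans (ler_wpM2r _ re) _ => //.
rewrite -mulrA gtr_pMr // mulrC ltr_pdivrMr // mul1r.
by rewrite /M (bigD1 i) //= addrCA ltrDl ltr_pwDl // sumr_ge0.
Qed.

(** The minimum of finitely many radii; it provides one perturbation size valid at all vertices of
    [P]. *)
Lemma uniform_radius (T : eqType) (s : seq T) (G : T -> R -> Prop) :
  (forall v, v \in s -> exists2 e : R, 0 < e & forall r, `|r| <= e -> G v r) ->
  exists2 e : R, 0 < e & forall v, v \in s -> forall r, `|r| <= e -> G v r.
Proof.
elim: s => [_|v s IH sG]; first by exists 1.
have [|e e0 He] := IH; first by move=> u su; apply: sG; rewrite inE su orbT.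
have [|d d0 Hd] := sG v; first by rewrite inE eqxx.
exists (Num.min d e) => [|u /predU1P[->|su] r]; first by rewrite lt_min d0.
  by rewrite le_min => /andP[rd _]; exact: Hd.
by rewrite le_min => /andP[_ re]; exact: He.
Qed.

(* With [f = t g + (1-t) h] and [D = g - f], the map [D] vanishes at the vertices
   of [P] sent to vertices.  If [D x0 != 0], choose a linear form [phi] with
   [phi (D x0) != 0] and a direction [l != 0] of the image: then
   [f +- e *: (phi (D x) *: l)] stays in the image of [f] for small [e], although
   [D] itself may leave the affine hull of the image.  This contradicts the
   extremality of [f_surj f]. *)
Lemma deflation_vertex_map P Q (f : P -> Q) :
  is_polytope P -> affine_map f ->
  (forall w, is_vertex (map_image f) w -> is_vertex Q w) ->
  deflation (f_surj f) -> vertex_map f.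
Proof.
move=> polP faff vQ [_ /vertex_mapP[_ surj_ext] defl].
apply/vertex_mapP; split=> // g h t gaff haff gQ hQ t01 fE.
have [A fA PE] := polP; have [s0 us0 AE] := finite_set_uniq_seq fA.
have [s [us sE sv]] := polytope_vertices us0.
have Ps : P = conv_hull [set` s] by rewrite PE AE sE.
have vertP v : v \in s -> is_vertex P v by move=> /sv; rewrite -AE -PE.
have sP : [set` s] `<=` P by move=> v /vertP[].
have Psub : P `<=` conv_hull [set` s] by rewrite {1}Ps.
have gvert v : is_vertex (map_image f) (val (f v)) -> g v = val (f v).
  by move=> /vQ[_ /(_ (g v) (h v) t)[]].
(* A constant [f] offers no direction [l]. Its image is a single point, hence a vertex of itself and
   so of [Q]. *)
have [cst|] := pselect (forall x y, f x = f y).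
  apply: (is_affine_eq Psub sP) => // v _; apply: gvert.
  apply: is_vertexI; first by exists v.
  by move=> _ _ _ [x _ <-] _ _ _; rewrite (cst x v).
move=> /existsNP[x1 /existsNP[x2 x12]] x0; apply: contrapT => gx0.
pose D x := g x - val (f x); pose b := vbasis {:W}.
pose l := val (f x1) - val (f x2).
have l0 : l != 0 by rewrite subr_eq0; apply/eqP => /val_inj.
have [i Di] : exists i, coord b i (D x0) != 0.
  apply: contrapT => /forallNP D0; apply: gx0; apply/eqP.
  rewrite -subr_eq0 -/(D x0) (coord_vbasis (memvf (D x0))) big1 // => i _.
  by have /negP := D0 i; rewrite negbK => /eqP ->; rewrite scale0r.
pose k (r : R) (x : P) := val (f x) + r *: (coord b i (D x) *: l).
have kaff r : is_affine (k r).
  apply: is_affineD => //.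
  apply: (@is_affine_linear _ _ _ _ _ (GRing.scale r)).
  apply: is_affine_scaler; apply: is_affine_linear.
  by apply: is_affineD => //; exact: (@is_affine_linear _ _ _ _ _ -%R).
have [e e0 ke] : exists2 e : R, 0 < e & forall v, v \in s ->
    forall r, `|r| <= e -> forall x : P, val x = v -> map_image f (k r x).
  apply: uniform_radius => v sv'; pose x : P := SigSub (mem_set (sP v sv')).
  suff [e e0 ke] : exists2 e : R, 0 < e &
      forall r, `|r| <= e -> map_image f (k r x).
    exists e => // r re y yv; have -> : y = x by exact: val_inj.
    exact: ke.
  have [vx|ix] := defl x (vertP v sv').
    exists 1 => // r _; rewrite /k /D gvert // subrr linear0 scale0r scaler0 addr0.
    by exists x.
  apply: (rel_interior_absorb ix) => r; set c := coord b i (D x).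
  (* Since [l] is a difference of two image points, moving along it is an affine combination of
     three image points with weights 1, [r * c], [- (r * c)]. *)
  exists 3%N, (fun j => [:: 1; r * c; - (r * c)]`_j),
    (fun j => [:: val (f x); val (f x1); val (f x2)]`_j); split.
  - by case=> [[|[|[|//]]]] /= _; eexists.
  - by rewrite !big_ord_recl big_ord0 /= addr0 subrr addr0.
  - rewrite !big_ord_recl big_ord0 /= addr0 scale1r scalerA.
    by rewrite scaleNr -scalerBr.
(* The image is convex, so control at the vertices of [P] extends to all of [P]. *)
have kP r : `|r| <= e -> forall x, map_image f (k r x).
  move=> re; apply: (is_affine_conv Psub sP (kaff r)) => [|v vs].
    exact: conv_hull_map_image.
  exact: (ke _ vs).
have := surj_ext (k e) (k (- e)) (2^-1) (kaff _) (kaff _).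
move=> /(_ (kP _ _) (kP _ _)); rewrite normrN gtr0_norm // lexx.
move=> /(_ isT isT) H; have : k e x0 = val (f x0).
  apply: H => [|x]; first by lra.
  have -> : (1 - 2^-1 : R) = 2^-1 by lra.
  rewrite -scalerDr /k scaleNr addrACA subrr addr0 scalerDr -scalerDl.
  have -> : (2^-1 : R) + 2^-1 = 1 by lra.
  by rewrite scale1r.
move=> /eqP; rewrite /k -subr_eq0 addrC addKr !scaler_eq0 gt_eqF //=.
by rewrite (negPf Di) (negPf l0).
Qed.

End Factorization.

(** * Vertices detected by supporting linear forms *)

Section SupportingForms.
Variables (R : realType) (E : lmodType R).
Implicit Types (C : set E) (l : E -> R^o).

(** [l x] is a mean, with positive weights, of two values that do not exceed it. *)
Lemma supporting_form_eq C l (x y z : E) (t : R) : linear l ->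
  (forall w, C w -> l w <= l x) -> C y -> C z -> 0 < t < 1 ->
  x = t *: y + (1 - t) *: z -> l y = l x.
Proof.
move=> lin lC Cy Cz t01 xE.
pose L := HB.pack_for {linear E -> R^o} l (GRing.isLinear.Build _ _ _ _ l lin).
have lxE : l x = t * l y + (1 - t) * l z.
  by rewrite {1}xE -[l]/(L : E -> R^o) linearD !linearZ.
have ty : 0 <= t * (l x - l y) by rewrite mulr_ge0 ?subr_ge0 ?lC //; lra.
have tz : 0 <= (1 - t) * (l x - l z).
  by rewrite mulr_ge0 ?subr_ge0 ?lC //; lra.
have /eqP : t * (l x - l y) = 0 by lra.
by rewrite mulf_eq0 gt_eqF /= ?subr_eq0 => [/eqP|]; lra.
Qed.

Lemma is_vertex_supporting_forms C l1 l2 (x : E) : linear l1 -> linear l2 ->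
  C x -> (forall y, C y -> l1 y <= l1 x) -> (forall y, C y -> l2 y <= l2 x) ->
  (forall y, l1 y = l1 x -> l2 y = l2 x -> y = x) -> is_vertex C x.
Proof.
move=> lin1 lin2 Cx C1 C2 sep; apply: is_vertexI => // y z t Cy Cz t01 xE.
apply: sep; first exact: supporting_form_eq lin1 C1 Cy Cz t01 xE.
exact: supporting_form_eq lin2 C2 Cy Cz t01 xE.
Qed.

End SupportingForms.

(** * A non-extremal map with extremal factors *)

Section Trapezoid.
Variable R : realType.

Definition planar_form (a b : R) (x : R^o * R^o) : R^o := a * x.1 + b * x.2.

Lemma planar_form_linear a b : linear (planar_form a b).
Proof. by move=> c [x1 x2] [y1 y2]; rewrite /planar_form /= /GRing.scale /=; ring. Qed.

Definition triangle : set (R^o * R^o)%type :=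
  conv_hull [set` [:: (0, 0); (2, 0); (0, 2)] : seq (R^o * R^o)%type].

Lemma triangleP (x : R^o * R^o) :
  triangle x <-> [/\ 0 <= x.1, 0 <= x.2 & x.1 + x.2 <= 2].
Proof.
split=> [Tx|].
  have form a b k : 0 <= k -> a * 2 <= k -> b * 2 <= k ->
      a * x.1 + b * x.2 <= k.
    move=> k0 ak bk; apply: (conv_hull_halfspace (planar_form_linear a b)) Tx.
    by move=> y /=; rewrite !inE => /or3P[]/eqP ->; rewrite /planar_form /=; lra.
  have := form (-1) 0 0; have := form 0 (-1) 0; have := form 1 1 2.
  by move=> H1 H2 H3; split; lra.
(* The coordinates are regeneralized at type [R] instead of [R^o] for the arithmetic; the witnesses
   below are barycentric coordinates. *)
case: x => u v; move: (u : R) (v : R) => {}u {}v /= [u0 v0 uv].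
exists 3%N, (fun j => ([:: 1 - u / 2 - v / 2; u / 2; v / 2] : seq R)`_j),
  (fun j => [:: (0, 0); (2, 0); (0, 2)]`_j); split.
- by case=> [[|[|[|//]]]] /= _; rewrite !inE eqxx ?orbT.
- by case=> [[|[|[|//]]]] /= _; lra.
- by rewrite !big_ord_recl big_ord0 /=; lra.
- rewrite !big_ord_recl big_ord0; congr (_, _).
    change (u = (1 - u / 2 - v / 2) * 0 + (u / 2 * 2 + (v / 2 * 0 + 0))); lra.
  change (v = (1 - u / 2 - v / 2) * 0 + (u / 2 * 0 + (v / 2 * 2 + 0))); lra.
Qed.

Definition simplex_points : seq (R^o * R^o * R^o)%type :=
  [:: (0, 0, 0); (1, 0, 0); (0, 1, 0); (0, 0, 1)].

Definition tetrahedron : set (R^o * R^o * R^o)%type :=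
  conv_hull [set` simplex_points].

Lemma tetrahedron_bounds (x : R^o * R^o * R^o) : tetrahedron x ->
  [/\ 0 <= x.1.1, 0 <= x.1.2, 0 <= x.2 & x.1.1 + x.1.2 + x.2 <= 1].
Proof.
move=> Tx.
have form a b c k : 0 <= k -> a <= k -> b <= k -> c <= k ->
    a * x.1.1 + b * x.1.2 + c * x.2 <= k.
  move=> k0 ak bk ck.
  pose l (y : R^o * R^o * R^o) : R^o := a * y.1.1 + b * y.1.2 + c * y.2.
  have lin : linear l.
    by move=> d [[? ?] ?] [[? ?] ?]; rewrite /l /= /GRing.scale /=; ring.
  apply: (conv_hull_halfspace lin) Tx => y /=.
  by rewrite !inE => /or4P[]/eqP ->; rewrite /l /=; lra.
have := form (-1) 0 0 0; have := form 0 (-1) 0 0; have := form 0 0 (-1) 0.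
have := form 1 1 1 1.
by move=> H1 H2 H3 H4; split; lra.
Qed.

(* For [k = 1] this sends the points of the simplex to the vertices of the
   trapezoid with corners (0,0), (2,0), (0,1), (1,1); the parameter slides the
   third corner along an edge of the triangle, from (0,0) to (0,2). *)
Definition trap_map (k : R) (x : R^o * R^o * R^o) : R^o * R^o :=
  (2 * x.1.1 + x.2, k * x.1.2 + x.2).

Lemma trap_map_linear k : linear (trap_map k).
Proof.
by move=> c [[? ?] ?] [[? ?] ?]; congr (_, _); rewrite /= /GRing.scale /=; ring.
Qed.

Lemma trap_map_affine k :
  is_affine (fun x : tetrahedron => trap_map k (val x)).
Proof.
pose L := HB.pack_for {linear (R^o * R^o * R^o)%type -> (R^o * R^o)%type}
  (trap_map k) (GRing.isLinear.Build _ _ _ _ (trap_map k) (trap_map_linear k)).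
exact: (is_affine_linear L (@is_affine_val _ _ _)).
Qed.

Lemma trap_map_triangle k (x : tetrahedron) : 0 <= k <= 2 ->
  triangle (trap_map k (val x)).
Proof.
move=> k02; have [x1 x2 x3 x123] := tetrahedron_bounds (set_valP x).
by apply/triangleP; rewrite /trap_map /=; split; nra.
Qed.

Lemma unit_in02 : 0 <= (1 : R) <= 2.
Proof. by lra. Qed.

Definition trap (x : tetrahedron) : triangle :=
  SigSub (mem_set (trap_map_triangle x unit_in02)).

Lemma trap_affine : affine_map trap.
Proof. exact: trap_map_affine. Qed.

Lemma trap_bounds (y : R^o * R^o) : map_image trap y ->
  [/\ 0 <= y.1, 0 <= y.2, y.2 <= 1 & y.1 + y.2 <= 2].
Proof.
move=> [x _ <-]; have [x1 x2 x3 x123] := tetrahedron_bounds (set_valP x).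
by rewrite /= /trap_map /=; split; lra.
Qed.

Lemma trap_vertex (x : tetrahedron) : val x \in simplex_points ->
  is_vertex (map_image trap) (val (trap x)).
Proof.
have Cx : map_image trap (val (trap x)) by exists x.
have vert (u v a b c d : R) : val (trap x) = (u, v) ->
    (forall y1 y2, 0 <= y1 -> 0 <= y2 -> y2 <= 1 -> y1 + y2 <= 2 ->
       a * y1 + b * y2 <= a * u + b * v /\ c * y1 + d * y2 <= c * u + d * v) ->
    a * d - b * c != 0 -> is_vertex (map_image trap) (val (trap x)).
  move=> xE le_uv det; rewrite xE in Cx *.
  apply: (is_vertex_supporting_forms (planar_form_linear a b)
    (planar_form_linear c d)) => //.
  - by move=> y /trap_bounds[y1 y2 y3 y4]; have [] := le_uv _ _ y1 y2 y3 y4.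
  - by move=> y /trap_bounds[y1 y2 y3 y4]; have [] := le_uv _ _ y1 y2 y3 y4.
  case=> y1 y2; rewrite /planar_form /= => E1 E2.
  (* Cramer's rule: two independent forms determine the point. *)
  congr (_, _); apply: (mulfI det).
    have -> : (a * d - b * c) * y1 =
      d * (a * y1 + b * y2) - b * (c * y1 + d * y2) by ring.
    by rewrite E1 E2; ring.
  have -> : (a * d - b * c) * y2 =
    a * (c * y1 + d * y2) - c * (a * y1 + b * y2) by ring.
  by rewrite E1 E2; ring.
rewrite !inE => /or4P[]/eqP xE.
(* For each corner, the two forms are outer normals of the sides of the trapezoid meeting there. *)
- apply: (vert 0 0 (-1) 0 0 (-1)).
  + by rewrite /= xE; congr (_, _); rewrite /=; ring.
  + by move=> {xE vert Cx} y1 y2 *; split; lra.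
  + by apply/negP => {xE vert Cx} /eqP; lra.
- apply: (vert 2 0 1 1 0 (-1)).
  + by rewrite /= xE; congr (_, _); rewrite /=; ring.
  + by move=> {xE vert Cx} y1 y2 *; split; lra.
  + by apply/negP => {xE vert Cx} /eqP; lra.
- apply: (vert 0 1 (-1) 0 0 1).
  + by rewrite /= xE; congr (_, _); rewrite /=; ring.
  + by move=> {xE vert Cx} y1 y2 *; split; lra.
  + by apply/negP => {xE vert Cx} /eqP; lra.
- apply: (vert 1 1 1 1 0 1).
  + by rewrite /= xE; congr (_, _); rewrite /=; ring.
  + by move=> {xE vert Cx} y1 y2 *; split; lra.
  + by apply/negP => {xE vert Cx} /eqP; lra.
Qed.

Lemma simplex_points_sub : [set` simplex_points] `<=` tetrahedron.
Proof. exact: sub_conv_hull. Qed.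

(** All four simplex points go to vertices of the image, where any decomposition is trivial; an
    affine map is determined by its values at these points. *)
Lemma trap_deflation : deflation (f_surj trap).
Proof.
split; first exact: map_image_f_surj.
  apply/vertex_mapP; split; first exact: trap_affine.
  move=> g h t gaff haff gQ hQ t01 fE.
  apply: (@is_affine_eq _ _ _ _ [set` simplex_points]) => //.
  - exact: simplex_points_sub.
  - exact: trap_affine.
  move=> v /trap_vertex[_ /(_ (g v) (h v) t)[]//]; exact: fE.
by move=> v /conv_hull_vertex/trap_vertex vv; left.
Qed.

Lemma simplex_point_lift v : v \in simplex_points ->
  exists x : tetrahedron, val x = v.
Proof. by move=> /simplex_points_sub Tv; exists (SigSub (mem_set Tv)). Qed.

(** [trap] is the midpoint of [trap_map 0] and [trap_map 2], which both map into the triangle but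
    differ from it at [(0, 1, 0)]. *)
Lemma trap_not_vertex_map : ~ vertex_map trap.
Proof.
move=> /vertex_mapP[_ ext].
have [|p pE] := @simplex_point_lift (0, 1, 0); first by rewrite !inE eqxx ?orbT.
have k0 : 0 <= (0 : R) <= 2 by lra.
have k2 : 0 <= (2 : R) <= 2 by lra.
have h01 : 0 < (2^-1 : R) < 1 by move=> {pE}; lra.
have fE x : val (trap x) =
    2^-1 *: trap_map 0 (val x) + (1 - 2^-1) *: trap_map 2 (val x).
  rewrite -[LHS]/(trap_map 1 (val x)); move: (val x) => {pE} [[a b] c]; congr (_, _).
    change (2 * a + c = 2^-1 * (2 * a + c) + (1 - 2^-1) * (2 * a + c) :> R); lra.
  change (1 * b + c = 2^-1 * (0 * b + c) + (1 - 2^-1) * (2 * b + c) :> R); lra.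
have := ext _ _ _ (trap_map_affine 0) (trap_map_affine 2)
  (fun x => trap_map_triangle x k0) (fun x => trap_map_triangle x k2) h01 fE p.
move=> /(congr1 snd); rewrite /= pE /= !mulr1 !addr0 => /eqP.
by rewrite eq_sym oner_eq0.
Qed.

(* The corners (0,0) and (2,0) are vertices of the triangle, hence fixed; the
   corners (0,1) and (1,1) stay on their edges, and since these edges are not
   parallel while (1,1) - (0,1) is half of the fixed side, they cannot move. *)
Lemma trap_inj_vertex_map : vertex_map (f_inj trap).
Proof.
apply/vertex_mapP; split=> // g h t gaff haff gQ hQ t01 fE y.
have [x <-] := map_image_f_surj y; move: x {y}.
apply: (@is_affine_eq _ _ _ _ [set` simplex_points]
  (g \o f_surj trap) (fun x => val (trap x))) => //.
- exact: simplex_points_sub.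
- by apply: is_affine_comp => //; exact: trap_affine.
- exact: trap_affine.
pose g1 x : R := (g (f_surj trap x)).1; pose g2 x : R := (g (f_surj trap x)).2.
(* A form maximal on the triangle at a corner of the trapezoid keeps its value there under [g]: the
   corner stays on its side of the triangle. *)
have face (a b u v : R) (x : tetrahedron) : val (trap x) = (u, v) ->
    (forall w1 w2, 0 <= w1 -> 0 <= w2 -> w1 + w2 <= 2 ->
       a * w1 + b * w2 <= a * u + b * v) ->
    a * g1 x + b * g2 x = a * u + b * v.
  move=> xE le_uv; have := supporting_form_eq (planar_form_linear a b) _
    (gQ _) (hQ _) t01 (fE (f_surj trap x)).
  have -> : val (f_inj trap (f_surj trap x)) = (u, v) by exact: xE.
  apply=> w /triangleP[w1 w2 w12].
  exact: le_uv.
have face1 v x : val (trap x) = (0, v) -> g1 x = 0.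
  by move=> /(face (-1) 0) H; have {}H := H (ltac:(move=> *; lra)); lra.
have face2 u x : val (trap x) = (u, 0) -> g2 x = 0.
  by move=> /(face 0 (-1)) H; have {}H := H (ltac:(move=> *; lra)); lra.
have face12 u v x : u + v = 2 -> val (trap x) = (u, v) -> g1 x + g2 x = 2.
  by move=> uv /(face 1 1) H; have {}H := H (ltac:(move=> *; lra)); lra.
have [|A AE] := @simplex_point_lift (0, 0, 0); first by rewrite !inE eqxx ?orbT.
have [|B BE] := @simplex_point_lift (1, 0, 0); first by rewrite !inE eqxx ?orbT.
have [|p pE] := @simplex_point_lift (0, 1, 0); first by rewrite !inE eqxx ?orbT.
have [|q qE] := @simplex_point_lift (0, 0, 1); first by rewrite !inE eqxx ?orbT.
have fA : val (trap A) = (0, 0).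
  by rewrite /= AE; congr (_, _); rewrite /=; ring.
have fB : val (trap B) = (2, 0).
  by rewrite /= BE; congr (_, _); rewrite /=; ring.
have fp : val (trap p) = (0, 1).
  by rewrite /= pE; congr (_, _); rewrite /=; ring.
have fq : val (trap q) = (1, 1).
  by rewrite /= qE; congr (_, _); rewrite /=; ring.
(* The parallelism [(1,1) = (0,1) + ((2,0) - (0,0)) / 2] holds among the images but not among the
   simplex points, so only maps affine on the trapezoid must respect it. *)
have gq : g (f_surj trap q) = g (f_surj trap p)
    + (2^-1 *: g (f_surj trap B) + (- 2^-1) *: g (f_surj trap A)).
  rewrite (gaff 3%N (fun j => ([:: 1; 2^-1; - 2^-1] : seq R)`_j)
    (fun j => nth (f_surj trap A) [:: f_surj trap p; f_surj trap B; f_surj trap A] j)).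
  - by rewrite !big_ord_recl big_ord0 /= scale1r addr0.
  - by rewrite !big_ord_recl big_ord0 /=; move=> {AE BE pE qE fA fB fp fq}; lra.
  - transitivity (1 *: val (trap p)
        + (2^-1 *: val (trap B) + (- 2^-1 *: val (trap A) + 0))); last first.
      by rewrite !big_ord_recl big_ord0.
    rewrite [LHS]fq fA fB fp.
    congr (_, _).
      change (1 = 1 * 0 + (2^-1 * 2 + (- 2^-1 * 0 + 0)) :> R).
      by move=> {AE BE pE qE fA fB fp fq}; lra.
    change (1 = 1 * 1 + (2^-1 * 0 + (- 2^-1 * 0 + 0)) :> R).
    by move=> {AE BE pE qE fA fB fp fq}; lra.
have gq1 : g1 q = g1 p + (2^-1 * g1 B + - 2^-1 * g1 A) by rewrite /g1 gq.
have gq2 : g2 q = g2 p + (2^-1 * g2 B + - 2^-1 * g2 A) by rewrite /g2 gq.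
have gA1 := face1 _ _ fA; have gA2 := face2 _ _ fA.
have gB2 := face2 _ _ fB; have gp1 := face1 _ _ fp.
have gB12 : g1 B + g2 B = 2 by apply: (face12 _ _ _ _ fB); rewrite addr0.
have gq12 : g1 q + g2 q = 2 by apply: (face12 _ _ _ _ fq).
have gE x (u v : R) : val (trap x) = (u, v) -> g1 x = u -> g2 x = v ->
    g (f_surj trap x) = val (trap x).
  by move=> ->; rewrite /g1 /g2; case: (g _) => ? ? /= -> ->.
have val_eq (x z : tetrahedron) w : val x = w -> val z = w -> x = z.
  by move=> <- zx; apply: val_inj.
(* The relations give [g1 q = 0 + 1], then [g2 q = 2 - 1], and finally [g2 p = g2 q = 1]. *)
move=> v /=; rewrite !inE => /or4P[]/eqP vE.
- by rewrite (val_eq _ _ _ vE AE); apply: (gE _ _ _ fA).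
- rewrite (val_eq _ _ _ vE BE); apply: (gE _ _ _ fB) => //.
  by move: gB2 gB12; clear; lra.
- rewrite (val_eq _ _ _ vE pE); apply: (gE _ _ _ fp) => //.
  by move: gA1 gA2 gB2 gB12 gp1 gq1 gq2 gq12; clear; lra.
- rewrite (val_eq _ _ _ vE qE); apply: (gE _ _ _ fq).
    by move: gA1 gA2 gB2 gB12 gp1 gq1 gq2 gq12; clear; lra.
  by move: gA1 gA2 gB2 gB12 gp1 gq1 gq2 gq12; clear; lra.
Qed.

End Trapezoid.

Theorem theorem4p1 (R : realType) :
  (forall (V W : vectType R) (P : set V) (Q : set W) (f : P -> Q),
     is_polytope P -> is_polytope Q -> affine_map f ->
     (vertex_map f -> vertex_map (f_inj f) /\ vertex_map (f_surj f))
     /\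
     ((forall w : W, is_vertex (map_image f) w -> is_vertex Q w) ->
        deflation (f_surj f) -> vertex_map f))
  /\
  (exists (V W : vectType R) (P : set V) (Q : set W) (f : P -> Q),
     [/\ is_polytope P, is_polytope Q & affine_map f] /\
     [/\ ~ vertex_map f, vertex_map (f_inj f) & deflation (f_surj f)])
  /\
  ~ (forall (V W : vectType R) (P : set V) (Q : set W) (f : P -> Q),
       is_polytope P -> is_polytope Q -> affine_map f ->
       vertex_map (f_inj f) /\ vertex_map (f_surj f) -> vertex_map f).
Proof.
have polP : is_polytope (@tetrahedron R).
  by exists [set` @simplex_points R] => //; exact: finite_seq.
have polQ : is_polytope (@triangle R).
  by eexists; last reflexivity; exact: finite_seq.
split; [|split].
- move=> V W P Q f pP pQ faff; split; last exact: deflation_vertex_map.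
  by move=> vf; split; [exact: vertex_map_f_inj|exact: vertex_map_f_surj].
- exists _, _, (@tetrahedron R), (@triangle R), (@trap R); split; split=> //.
  + exact: trap_affine.
  + exact: trap_not_vertex_map.
  + exact: trap_inj_vertex_map.
  + exact: trap_deflation.
(* The same map refutes the converse, since a deflation is in particular a vertex map. *)
- move=> conv; apply: (@trap_not_vertex_map R); apply: conv => //.
    exact: trap_affine.
  by split; [exact: trap_inj_vertex_map|case: (trap_deflation R)].
Qed.
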